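(* (i) The linear span $\mathcal O^{\rightharpoonup}_{DPO}$ of all basis elements $\omega^r_{O,O'}:=\delta([O,O',r])\in\mathcal R_{DPO}$ with $|V_O|=|V_{O'}|$ and $|E_O|=|E_{O'}|$ is closed under $*_{DPO}$, hence a subalgebra of $\mathcal R_{DPO}$. (ii) The algebra of elements of the form $$\mathfrak D_{obs}:=\{\omega^r_{O,O'}\in\mathcal O^{\rightharpoonup}_{DPO}\mid O\cong O'\ \wedge\ r\subseteq\mathrm{id}_O\}$$ (i.e. their linear span) is a commutative subalgebra of $\mathcal O^{\rightharpoonup}_{DPO}$.
   Context: $\mathbb K$ is a field (such as $\mathbb R$ or $\mathbb C$). Graphs are finite directed multigraphs (loops allowed). A linear rule $r:I\rightharpoonup O$ is an injective partial graph morphism: a pair of one-to-one relations $r\subseteq(V_I\times V_O)\uplus(E_I\times E_O)$ (distinct pairs differ in both entries) with $(e,e')\in r\Rightarrow(s(e),s(e')),(t(e),t(e'))\in r$ for edges. $[I,O,r]$ denotes its isomorphism class (under pairs of graph isomorphisms of $I$ and of $O$). The vector space underlying the rule algebra $\mathcal R_{DPO}$ has as basis the isomorphism classes of linear rules, $\delta([I,O,r])$ being the basis vectors; $r_\emptyset=\delta([\emptyset,\emptyset,\emptyset])$. Product. For rules $\rho_1=[I_1,O_1,r_1]$, $\rho_2=[I_2,O_2,r_2]$ a match is a one-to-one relation $m$ from $O_2$ to $I_1$ (vertices to vertices, edges to edges, possibly empty) such that for matched edges $(e,e')\in m$ also $(s(e),s(e')),(t(e),t(e'))\in m$. The composite along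 $m$ has interfaces $\mathcal I=I_2\uplus(I_1\setminus\mathrm{im}(m))$, $\mathcal O=O_1\uplus(O_2\setminus\mathrm{dom}(m))$; the relation from $\mathcal I$ to $\mathcal O$ is the restriction of $r_1\cup r_2\cup (r_1\circ m\circ r_2)$. An edge of $I_1$ in $\mathcal I$ whose endpoint $v$ is matched, $(v',v)\in m$, gets as endpoint the $w\in I_2$ with $(w,v')\in r_2$ if it exists, and otherwise the endpoint is missing; an edge of $O_2$ in $\mathcal O$ whose endpoint $v'$ is matched, $(v',v)\in m$, gets as endpoint the $w\in O_1$ with $(v,w)\in r_1$ if it exists, and otherwise it is missing; all other endpoints are unchanged. If some edge has a missing endpoint, the composite along $m$ is replaced by $0$. $\delta(\rho_1)*_{DPO}\delta(\rho_2)$ is the sum of the composites over all matches $m$, extended bilinearly; $\mathcal R_{DPO}$ is an associative algebra with unit $r_\emptyset$. The condition ''$O\cong O'$ and $r\subseteq\mathrm{id}_O$'' means that, up to isomorphism of rules, $O'=O$ and $r$ is contained (as a relation) in the identity of $O$; equivalently there is a graph isomorphism $f:O\to O'$ with $r\subseteq f$. *)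

(* Defs.v *)
From HB Require Import structures.
From mathcomp Require Import all_boot all_order all_algebra.
From mathcomp Require Import finmap.
From mathcomp.multinomials Require Import monalg.

Set Implicit Arguments.
Unset Strict Implicit.
Unset Printing Implicit Defensive.

Import GRing.Theory.
Local Open Scope ring_scope.
Local Open Scope quotient_scope.

Section Relations.
Variables A B C : finType.
Implicit Types (r : {set A * B}) (s : {set B * C}).

Definition one_to_one r : bool :=
  [forall p in r, forall q in r, (p != q) ==> (p.1 != q.1) && (p.2 != q.2)].

Definition rdom r : {set A} := [set p.1 | p in r].
Definition rim r : {set B} := [set p.2 | p in r].

(* In diagrammatic order: first r, then s. *)
Definition rcomp r s : {set A * C} :=
  [set p | [exists b, ((p.1, b) \in r) && ((b, p.2) \in s)]].

Definition rinv r : {set B * A} := [set p | (p.2, p.1) \in r].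

Definition idrel : {set A * A} := [set p | p.1 == p.2].

Lemma one_to_oneP r :
  reflect ((forall a b b', (a, b) \in r -> (a, b') \in r -> b = b') /\
           (forall a a' b, (a, b) \in r -> (a', b) \in r -> a = a'))
          (one_to_one r).
Proof.
apply: (iffP forall_inP) => [H | [H1 H2] [a b] h].
  split=> [a b b'|a a' b] h h'; apply/eqP/negPn/negP => ne.
    have /forall_inP/(_ _ h') := H _ h.
    by rewrite xpair_eqE /= eqxx (negbTE ne).
  have /forall_inP/(_ _ h') := H _ h.
  by rewrite xpair_eqE /= eqxx (negbTE ne).
apply/forall_inP => -[a' b'] h' /=; apply/implyP; apply: contraNT.
rewrite negb_and !negbK => /orP[] /eqP e; subst.
  by rewrite (H1 _ _ _ h h').
by rewrite (H2 _ _ _ h h').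
Qed.

Lemma rdomP r a : reflect (exists b, (a, b) \in r) (a \in rdom r).
Proof.
apply: (iffP imsetP) => [[[x y] h ->]|[b h]]; first by exists y.
by exists (a, b).
Qed.

Lemma rimP r b : reflect (exists a, (a, b) \in r) (b \in rim r).
Proof.
apply: (iffP imsetP) => [[[x y] h ->]|[a h]]; first by exists x.
by exists (a, b).
Qed.

Lemma rcompP r s a c :
  reflect (exists b, (a, b) \in r /\ (b, c) \in s) ((a, c) \in rcomp r s).
Proof.
rewrite inE /=; apply: (iffP existsP) => [[b /andP[]]|[b [h h']]].
  by exists b.
by exists b; rewrite h h'.
Qed.

Lemma rinvE r a b : ((b, a) \in rinv r) = ((a, b) \in r).
Proof. by rewrite inE. Qed.

End Relations.

Arguments idrel : clear implicits.

Record graph := Graph {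
  vert : finType;
  edge : finType;
  src : edge -> vert;
  tgt : edge -> vert }.

Definition emptyG : graph :=
  @Graph void void (fun e => e) (fun e => e).

Section Morphisms.
Variables G H : graph.

Definition is_pmorph (m : {set vert G * vert H} * {set edge G * edge H}) :=
  [&& one_to_one m.1, one_to_one m.2 &
      [forall p in m.2, ((src p.1, src p.2) \in m.1) &&
                        ((tgt p.1, tgt p.2) \in m.1)]].

(* Injective partial graph morphisms; both linear rules (from I to O) and
   matches (from O_2 to I_1) are of this form. *)
Record pmorph := PMorph { prel; _ : is_pmorph prel }.

HB.instance Definition _ := [isSub for prel].
HB.instance Definition _ := [Finite of pmorph by <:].

Definition relV (m : pmorph) : {set vert G * vert H} := (prel m).1.
Definition relE (m : pmorph) : {set edge G * edge H} := (prel m).2.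

Definition is_giso (f : {ffun vert G -> vert H} * {ffun edge G -> edge H}) :=
  [&& injectiveb f.1, [forall v, v \in codom f.1],
      injectiveb f.2, [forall e, e \in codom f.2] &
      [forall e, (src (f.2 e) == f.1 (src e)) && (tgt (f.2 e) == f.1 (tgt e))]].

Record giso := GIso { gmap; _ : is_giso gmap }.

HB.instance Definition _ := [isSub for gmap].
HB.instance Definition _ := [Finite of giso by <:].

Definition isoV (f : giso) : vert G -> vert H := (gmap f).1.
Definition isoE (f : giso) : edge G -> edge H := (gmap f).2.

Lemma relV_fun m a b b' : (a, b) \in relV m -> (a, b') \in relV m -> b = b'.
Proof. by have /and3P[/one_to_oneP[h _] _ _] := valP m; apply: h. Qed.

Lemma relV_inj m a a' b : (a, b) \in relV m -> (a', b) \in relV m -> a = a'.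
Proof. by have /and3P[/one_to_oneP[_ h] _ _] := valP m; apply: h. Qed.

Lemma relE_fun m a b b' : (a, b) \in relE m -> (a, b') \in relE m -> b = b'.
Proof. by have /and3P[_ /one_to_oneP[h _] _] := valP m; apply: h. Qed.

Lemma relE_inj m a a' b : (a, b) \in relE m -> (a', b) \in relE m -> a = a'.
Proof. by have /and3P[_ /one_to_oneP[_ h] _] := valP m; apply: h. Qed.

Lemma rel_src m e e' : (e, e') \in relE m -> (src e, src e') \in relV m.
Proof. by have /and3P[_ _ /forall_inP h] := valP m; move=> /h /andP[]. Qed.

Lemma rel_tgt m e e' : (e, e') \in relE m -> (tgt e, tgt e') \in relV m.
Proof. by have /and3P[_ _ /forall_inP h] := valP m; move=> /h /andP[]. Qed.

Lemma pmorph_eq (m m' : pmorph) :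
  relV m = relV m' -> relE m = relE m' -> m = m'.
Proof.
move=> hV hE; apply: val_inj => /=; move: hV hE; rewrite /relV /relE.
by case: (prel m) (prel m') => [? ?] [? ?] /= -> ->.
Qed.

Lemma isoV_bij f : bijective (isoV f).
Proof.
have /and5P[/injectiveP i /forallP s _ _ _] := valP f.
apply: inj_card_bij => //; rewrite -(card_codom i).
by apply/subset_leq_card/subsetP => v _; apply: s.
Qed.

Lemma isoE_bij f : bijective (isoE f).
Proof.
have /and5P[_ _ /injectiveP i /forallP s _] := valP f.
apply: inj_card_bij => //; rewrite -(card_codom i).
by apply/subset_leq_card/subsetP => v _; apply: s.
Qed.

Lemma iso_src f e : src (isoE f e) = isoV f (src e).
Proof. by have /and5P[_ _ _ _ /forallP/(_ e)/andP[/eqP]] := valP f. Qed.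

Lemma iso_tgt f e : tgt (isoE f e) = isoV f (tgt e).
Proof. by have /and5P[_ _ _ _ /forallP/(_ e)/andP[_ /eqP]] := valP f. Qed.

Lemma giso_subproof fV fE : bijective fV -> bijective fE ->
  (forall e, src (fE e) = fV (src e)) -> (forall e, tgt (fE e) = fV (tgt e)) ->
  is_giso (finfun fV, finfun fE).
Proof.
move=> bV bE hs ht; apply/and5P; split=> /=.
- by apply/injectiveP => x y; rewrite !ffunE; apply: bij_inj.
- case: bV => g _ h; apply/forallP => y; apply/codomP.
  by exists (g y); rewrite ffunE h.
- by apply/injectiveP => x y; rewrite !ffunE; apply: bij_inj.
- case: bE => g _ h; apply/forallP => y; apply/codomP.
  by exists (g y); rewrite ffunE h.
- by apply/forallP => e; rewrite !ffunE hs ht !eqxx.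
Qed.

Definition mk_giso fV fE bV bE hs ht : giso :=
  GIso (@giso_subproof fV fE bV bE hs ht).

Lemma mk_gisoV fV fE bV bE hs ht : isoV (@mk_giso fV fE bV bE hs ht) =1 fV.
Proof. by move=> v; rewrite /isoV /= ffunE. Qed.

Lemma mk_gisoE fV fE bV bE hs ht : isoE (@mk_giso fV fE bV bE hs ht) =1 fE.
Proof. by move=> v; rewrite /isoE /= ffunE. Qed.

End Morphisms.

Definition isomorphic (G H : graph) : Prop := inhabited (giso G H).

Lemma giso_id G : exists f : giso G G, isoV f =1 id /\ isoE f =1 id.
Proof.
have b T : bijective (@id T) by exists id.
exists (@mk_giso G G id id (b _) (b _) (fun=> erefl) (fun=> erefl)).
by split; [apply: mk_gisoV | apply: mk_gisoE].
Qed.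

Lemma giso_inv G H (f : giso G H) : exists g : giso H G,
  [/\ cancel (isoV f) (isoV g), cancel (isoV g) (isoV f),
      cancel (isoE f) (isoE g) & cancel (isoE g) (isoE f)].
Proof.
have [gV fgV gfV] := isoV_bij f; have [gE fgE gfE] := isoE_bij f.
have hs e : src (gE e) = gV (src e).
  by apply: (can_inj fgV); rewrite gfV -iso_src gfE.
have ht e : tgt (gE e) = gV (tgt e).
  by apply: (can_inj fgV); rewrite gfV -iso_tgt gfE.
have bV : bijective gV by exists (isoV f).
have bE : bijective gE by exists (isoE f).
by exists (mk_giso bV bE hs ht); split=> x; rewrite (mk_gisoV, mk_gisoE).
Qed.

Lemma giso_comp G H K (f : giso G H) (g : giso H K) : exists h : giso G K,
  isoV h =1 isoV g \o isoV f /\ isoE h =1 isoE g \o isoE f.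
Proof.
have bV := bij_comp (isoV_bij g) (isoV_bij f).
have bE := bij_comp (isoE_bij g) (isoE_bij f).
have hs e : src ((isoE g \o isoE f) e) = (isoV g \o isoV f) (src e).
  by rewrite /= !iso_src.
have ht e : tgt ((isoE g \o isoE f) e) = (isoV g \o isoV f) (tgt e).
  by rewrite /= !iso_tgt.
exists (mk_giso bV bE hs ht).
by split; [apply: mk_gisoV | apply: mk_gisoE].
Qed.

Record lrule := Rule { inp : graph; outp : graph; rel : pmorph inp outp }.

Definition rule_iso (R S : lrule) : bool :=
  [exists f : giso (inp R) (inp S), exists g : giso (outp R) (outp S),
     [forall a, forall b,
        ((isoV f a, isoV g b) \in relV (rel S)) == ((a, b) \in relV (rel R))]
     && [forall a, forall b,
        ((isoE f a, isoE g b) \in relE (rel S)) == ((a, b) \in relE (rel R))]].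

Lemma rule_isoP R S : reflect
  (exists (f : giso (inp R) (inp S)) (g : giso (outp R) (outp S)),
    (forall a b, ((isoV f a, isoV g b) \in relV (rel S))
                 = ((a, b) \in relV (rel R))) /\
    (forall a b, ((isoE f a, isoE g b) \in relE (rel S))
                 = ((a, b) \in relE (rel R))))
  (rule_iso R S).
Proof.
apply: (iffP existsP) => [[f /existsP[g /andP[hV hE]]]|[f [g [hV hE]]]].
  exists f, g; split=> a b; apply/eqP.
    by move/forallP/(_ a)/forallP/(_ b): hV.
  by move/forallP/(_ a)/forallP/(_ b): hE.
exists f; apply/existsP; exists g; apply/andP.
by split; apply/forallP => a; apply/forallP => b; rewrite (hV, hE).
Qed.

Lemma rule_iso_refl : reflexive rule_iso.
Proof.
move=> R; apply/rule_isoP.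
have [f [fV fE]] := giso_id (inp R); have [g [gV gE]] := giso_id (outp R).
by exists f, g; split=> a b; rewrite ?fV ?gV ?fE ?gE.
Qed.

Lemma rule_iso_sym : symmetric rule_iso.
Proof.
suff imp R S : rule_iso R S -> rule_iso S R by move=> R S; apply/idP/idP; apply: imp.
move=> /rule_isoP[f [g [hV hE]]]; apply/rule_isoP.
have [f' [_ fV _ fE]] := giso_inv f; have [g' [_ gV _ gE]] := giso_inv g.
by exists f', g'; split=> a b; rewrite -(hV, hE) ?fV ?gV ?fE ?gE.
Qed.

Lemma rule_iso_trans : transitive rule_iso.
Proof.
move=> S R T /rule_isoP[f [g [hV hE]]] /rule_isoP[f' [g' [hV' hE']]].
have [f2 [fV fE]] := giso_comp f f'; have [g2 [gV gE]] := giso_comp g g'.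
apply/rule_isoP; exists f2, g2.
by split=> a b; rewrite ?fV ?gV ?fE ?gE /= ?(hV', hE') ?(hV, hE).
Qed.

Lemma empty_pmorph_subproof G H : @is_pmorph G H (set0, set0).
Proof.
apply/and3P; split; first by apply/one_to_oneP; split=> ? ? ?; rewrite inE.
  by apply/one_to_oneP; split=> ? ? ?; rewrite inE.
by apply/forall_inP => ?; rewrite inE.
Qed.

Definition empty_rule : lrule :=
  Rule (PMorph (empty_pmorph_subproof emptyG emptyG)).

(* Rules between graphs on ordinals: a small choiceType meeting every
   isomorphism class, of which we can take the quotient. *)
Definition sgraph :=
  {d : nat * nat & {ffun 'I_d.2 -> 'I_d.1 * 'I_d.1}}.

Definition graph_of (G : sgraph) : graph :=
  Graph (fun e => (tagged G e).1) (fun e => (tagged G e).2).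

Definition srule :=
  {p : sgraph * sgraph & pmorph (graph_of p.1) (graph_of p.2)}.

Definition rule_of (R : srule) : lrule := Rule (tagged R).

Definition srule_iso (R S : srule) : bool := rule_iso (rule_of R) (rule_of S).

Lemma srule_iso_refl : reflexive srule_iso.
Proof. by move=> R; apply: rule_iso_refl. Qed.

Lemma srule_iso_sym : symmetric srule_iso.
Proof. by move=> R S; apply: rule_iso_sym. Qed.

Lemma srule_iso_trans : transitive srule_iso.
Proof. by move=> R S T; apply: rule_iso_trans. Qed.

Canonical srule_iso_equiv :=
  EquivRel srule_iso srule_iso_refl srule_iso_sym srule_iso_trans.

Definition rclass := {eq_quot srule_iso}.
HB.instance Definition _ := Choice.on rclass.

Definition repr_rule (c : rclass) : lrule := rule_of (repr c).

Section Transport.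
Variables (G H G' H' : graph) (f : giso G G') (g : giso H H').

Lemma transport_subproof (m : pmorph G H) :
  is_pmorph ([set (isoV f p.1, isoV g p.2) | p in relV m],
             [set (isoE f p.1, isoE g p.2) | p in relE m]).
Proof.
have fV := bij_inj (isoV_bij f); have gV := bij_inj (isoV_bij g).
have fE := bij_inj (isoE_bij f); have gE := bij_inj (isoE_bij g).
apply/and3P; split=> /=.
- apply/one_to_oneP; split=> x y z /imsetP[[a b] h [-> ->]] /imsetP[[c d] h'].
    by case=> /fV e ->; subst c; rewrite (relV_fun h h').
  by case=> -> /gV e; subst d; rewrite (relV_inj h h').
- apply/one_to_oneP; split=> x y z /imsetP[[a b] h [-> ->]] /imsetP[[c d] h'].
    by case=> /fE e ->; subst c; rewrite (relE_fun h h').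
  by case=> -> /gE e; subst d; rewrite (relE_inj h h').
- apply/forall_inP => _ /imsetP[[a b] h ->] /=.
  rewrite !iso_src !iso_tgt; apply/andP; split; apply/imsetP.
    by exists (src a, src b) => //; apply: rel_src.
  by exists (tgt a, tgt b) => //; apply: rel_tgt.
Qed.

Definition transport (m : pmorph G H) : pmorph G' H' :=
  PMorph (transport_subproof m).

Lemma transportV m a b :
  ((isoV f a, isoV g b) \in relV (transport m)) = ((a, b) \in relV m).
Proof.
rewrite /relV /=; apply/imsetP/idP => [[[c d] h [/= e e']]|h]; last by exists (a, b).
by rewrite (bij_inj (isoV_bij f) e) (bij_inj (isoV_bij g) e').
Qed.

Lemma transportE m a b :
  ((isoE f a, isoE g b) \in relE (transport m)) = ((a, b) \in relE m).
Proof.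
rewrite /relE /=; apply/imsetP/idP => [[[c d] h [/= e e']]|h]; last by exists (a, b).
by rewrite (bij_inj (isoE_bij f) e) (bij_inj (isoE_bij g) e').
Qed.

End Transport.

Definition std_graph (G : graph) : sgraph :=
  Tagged (fun d : nat * nat => {ffun 'I_d.2 -> 'I_d.1 * 'I_d.1})
    (i := (#|vert G|, #|edge G|))
    [ffun e => (enum_rank (src (enum_val e)), enum_rank (tgt (enum_val e)))].

Section StdIso.
Variable G : graph.

Let fV (v : vert G) : vert (graph_of (std_graph G)) := enum_rank v.
Let fE (e : edge G) : edge (graph_of (std_graph G)) := enum_rank e.

Let fV_bij : bijective fV. Proof. exact: enum_rank_bij. Qed.
Let fE_bij : bijective fE. Proof. exact: enum_rank_bij. Qed.
Let f_src e : src (fE e) = fV (src e).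
Proof. by rewrite /= ffunE /= enum_rankK. Qed.
Let f_tgt e : tgt (fE e) = fV (tgt e).
Proof. by rewrite /= ffunE /= enum_rankK. Qed.

Definition std_iso : giso G (graph_of (std_graph G)) :=
  mk_giso fV_bij fE_bij f_src f_tgt.
End StdIso.

Definition std_rule (R : lrule) : srule :=
  Tagged (fun p : sgraph * sgraph => pmorph (graph_of p.1) (graph_of p.2))
    (i := (std_graph (inp R), std_graph (outp R)))
    (transport (std_iso (inp R)) (std_iso (outp R)) (rel R)).

(* Locked, as delta below: unification may otherwise unfold enumerations. *)
HB.lock Definition cls (R : lrule) : rclass := \pi_rclass (std_rule R).

Lemma std_ruleP R : rule_iso R (rule_of (std_rule R)).
Proof.
apply/rule_isoP; exists (std_iso (inp R)), (std_iso (outp R)).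
by split=> a b; [apply: transportV | apply: transportE].
Qed.

Lemma cls_eq R S : (cls R == cls S) = rule_iso R S.
Proof.
rewrite !cls.unlock eqmodE /= /srule_iso; apply/idP/idP => h.
  apply: rule_iso_trans (std_ruleP R) _; apply: rule_iso_trans h _.
  by rewrite rule_iso_sym std_ruleP.
apply: rule_iso_trans _ (std_ruleP S); apply: rule_iso_trans _ h.
by rewrite rule_iso_sym std_ruleP.
Qed.

Lemma repr_ruleK c : cls (repr_rule c) = c.
Proof.
rewrite -[RHS]reprK cls.unlock; apply/eqP; rewrite eqmodE /= /srule_iso rule_iso_sym.
exact: std_ruleP.
Qed.

Lemma repr_clsP R : rule_iso R (repr_rule (cls R)).
Proof. by rewrite -cls_eq repr_ruleK. Qed.

Section Glue.
Variables (G H : graph).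
Variables (bV : {set vert H}) (bE : {set edge H}) (lk : {set vert H * vert G}).

(* The graph G + (H \ (bV, bE)); an endpoint in bV of a surviving edge of H is
   redirected along lk, and [None] is a missing endpoint. *)
Definition gvert : finType := (vert G + {v : vert H | v \notin bV})%type.
Definition gedge : finType := (edge G + {e : edge H | e \notin bE})%type.

Definition endpoint (v : vert H) : option gvert :=
  if insub v is Some u then Some (inr u)
  else omap inl [pick w | (v, w) \in lk].

Lemma endpointP v z : Some z = endpoint v ->
  match z return Prop with inl w => (v, w) \in lk | inr u => val u = v end.
Proof.
rewrite /endpoint; case: insubP => [u _ <- [->]|_] //.
by case: pickP => //= w h [->].
Qed.

Definition gsrc (e : gedge) : option gvert :=
  match e with
  | inl a => Some (inl (src a))
  | inr a => endpoint (src (val a))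
  end.

Definition gtgt (e : gedge) : option gvert :=
  match e with
  | inl a => Some (inl (tgt a))
  | inr a => endpoint (tgt (val a))
  end.

Definition glue_ok : bool := [forall e, isSome (gsrc e) && isSome (gtgt e)].

Definition oget T (o : option T) : isSome o -> T :=
  match o with Some x => fun=> x | None => fun h => match notF h with end end.

Lemma ogetK T (o : option T) (h : isSome o) : Some (oget h) = o.
Proof. by case: o h. Qed.

Lemma gsrcP : glue_ok -> forall e, isSome (gsrc e).
Proof. by move=> /forallP h e; case/andP: (h e). Qed.

Lemma gtgtP : glue_ok -> forall e, isSome (gtgt e).
Proof. by move=> /forallP h e; case/andP: (h e). Qed.

Definition glue (ok : glue_ok) : graph :=
  Graph (fun e => oget (gsrcP ok e)) (fun e => oget (gtgtP ok e)).

Lemma glue_src ok e : Some (src (g := glue ok) e) = gsrc e.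
Proof. exact: ogetK. Qed.

Lemma glue_tgt ok e : Some (tgt (g := glue ok) e) = gtgt e.
Proof. exact: ogetK. Qed.

End Glue.

(* The restriction of the union of r1, r2 and r1 o m o r2 to the vertices
   (or edges) of the composite interfaces. *)
Definition comp_rel (I1 O1 I2 O2 : finType) (r1 : {set I1 * O1})
    (m : {set O2 * I1}) (r2 : {set I2 * O2}) :
    {set (I2 + {x | x \notin rim m}) * (O1 + {y | y \notin rdom m})} :=
  [set p | match p with
           | (inl x, inl y) => (x, y) \in rcomp r2 (rcomp m r1)
           | (inl x, inr y) => (x, val y) \in r2
           | (inr x, inl y) => (val x, y) \in r1
           | (inr _, inr _) => false
           end].

Lemma comp_relE (I1 O1 I2 O2 : finType) (r1 : {set I1 * O1})
    (m : {set O2 * I1}) (r2 : {set I2 * O2})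
    (x : I2 + {x | x \notin rim m}) (y : O1 + {y | y \notin rdom m}) :
  ((x, y) \in comp_rel r1 m r2) =
  match x, y with
  | inl x, inl y => (x, y) \in rcomp r2 (rcomp m r1)
  | inl x, inr y => (x, val y) \in r2
  | inr x, inl y => (val x, y) \in r1
  | inr _, inr _ => false
  end.
Proof. by rewrite in_set; case: x y => ? [?|?]. Qed.

Lemma comp_rel_1to1 (I1 O1 I2 O2 : finType) (r1 : {set I1 * O1})
    (m : {set O2 * I1}) (r2 : {set I2 * O2}) :
  one_to_one r1 -> one_to_one m -> one_to_one r2 ->
  one_to_one (comp_rel r1 m r2).
Proof.
move=> /one_to_oneP[f1 i1] /one_to_oneP[fm im] /one_to_oneP[f2 i2].
apply/one_to_oneP; split.
- move=> [x|x] [y|y] [z|z]; rewrite !comp_relE //=.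
  + move=> /rcompP[b [h /rcompP[c [h1 h2]]]] /rcompP[b' [h' /rcompP[c' [h1' h2']]]].
    have e := f2 _ _ _ h h'; subst b'; have e := fm _ _ _ h1 h1'; subst c'.
    by rewrite (f1 _ _ _ h2 h2').
  + move=> /rcompP[b [h /rcompP[c [h1 h2]]]] h'; have e := f2 _ _ _ h h'; subst b.
    by have /rdomP[] := valP z; exists c.
  + move=> h' /rcompP[b [h /rcompP[c [h1 h2]]]]; have e := f2 _ _ _ h h'; subst b.
    by have /rdomP[] := valP y; exists c.
  + by move=> h h'; congr inr; apply/val_inj/(f2 _ _ _ h h').
  + by move=> h h'; congr inl; apply/(f1 _ _ _ h h').
- move=> [x|x] [y|y] [z|z]; rewrite !comp_relE //=.
  + move=> /rcompP[b [h /rcompP[c [h1 h2]]]] /rcompP[b' [h' /rcompP[c' [h1' h2']]]].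
    have e := i1 _ _ _ h2 h2'; subst c'; have e := im _ _ _ h1 h1'; subst b'.
    by rewrite (i2 _ _ _ h h').
  + by move=> h h'; congr inl; apply/(i2 _ _ _ h h').
  + move=> /rcompP[b [h /rcompP[c [h1 h2]]]] h'; have e := i1 _ _ _ h2 h'; subst c.
    by have /rimP[] := valP y; exists b.
  + move=> h' /rcompP[b [h /rcompP[c [h1 h2]]]]; have e := i1 _ _ _ h2 h'; subst c.
    by have /rimP[] := valP x; exists b.
  + by move=> h h'; congr inr; apply/val_inj/(i1 _ _ _ h h').
Qed.

Section Composite.
Variables (R1 R2 : lrule) (m : pmorph (outp R2) (inp R1)).

Let r1 := rel R1.
Let r2 := rel R2.

Definition inp_link : {set vert (inp R1) * vert (inp R2)} :=
  rinv (rcomp (relV r2) (relV m)).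
Definition outp_link : {set vert (outp R2) * vert (outp R1)} :=
  rcomp (relV m) (relV r1).

Definition inp_ok : bool := glue_ok (rim (relV m)) (rim (relE m)) inp_link.
Definition outp_ok : bool := glue_ok (rdom (relV m)) (rdom (relE m)) outp_link.

Definition comp_inp (ok : inp_ok) : graph := glue ok.
Definition comp_outp (ok : outp_ok) : graph := glue ok.

Lemma comp_rel_pmorph (okI : inp_ok) (okO : outp_ok) :
  @is_pmorph (comp_inp okI) (comp_outp okO)
    (comp_rel (relV r1) (relV m) (relV r2),
     comp_rel (relE r1) (relE m) (relE r2)).
Proof.
have /and3P[r1V r1E _] := valP r1; have /and3P[r2V r2E _] := valP r2.
have /and3P[mV mE _] := valP m.
apply/and3P; split; [exact: comp_rel_1to1 .. |].
apply/forall_inP => -[x y]; rewrite comp_relE /= => h.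
rewrite -[oget (gsrcP okI x)]/(src (g := glue okI) x)
  -[oget (gtgtP okI x)]/(tgt (g := glue okI) x)
  -[oget (gsrcP okO y)]/(src (g := glue okO) y)
  -[oget (gtgtP okO y)]/(tgt (g := glue okO) y).
move: (@glue_src _ _ _ _ _ okI x) (@glue_tgt _ _ _ _ _ okI x)
      (@glue_src _ _ _ _ _ okO y) (@glue_tgt _ _ _ _ _ okO y).
rewrite /comp_inp /comp_outp.
move: (src x) (tgt x) (src y) (tgt y) => sx tx sy ty.
case: x y h => x [y|y] //= h.
- case/rcompP: h => b [h /rcompP[c [h1 h2]]] [->] [->] [->] [->].
  rewrite !comp_relE; apply/andP; split; apply/rcompP.
    exists (src b); split; first exact: rel_src.
    by apply/rcompP; exists (src c); split; apply: rel_src.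
  exists (tgt b); split; first exact: rel_tgt.
  by apply/rcompP; exists (tgt c); split; apply: rel_tgt.
- move=> [->] [->] /endpointP hs /endpointP ht; rewrite !comp_relE.
  apply/andP; split.
    case: sy hs => [w hs|u ->]; last exact: rel_src.
    by apply/rcompP; exists (src (val y)); split=> //; apply: rel_src.
  case: ty ht => [w ht|u ->]; last exact: rel_tgt.
  by apply/rcompP; exists (tgt (val y)); split=> //; apply: rel_tgt.
- move=> /endpointP hs /endpointP ht [->] [->]; rewrite !comp_relE.
  apply/andP; split.
    case: sx hs => [w|u ->]; last exact: rel_src.
    rewrite rinvE => /rcompP[b [h1 h2]]; apply/rcompP; exists b; split=> //.
    by apply/rcompP; exists (src (val x)); split=> //; apply: rel_src.
  case: tx ht => [w|u ->]; last exact: rel_tgt.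
  rewrite rinvE => /rcompP[b [h1 h2]]; apply/rcompP; exists b; split=> //.
  by apply/rcompP; exists (tgt (val x)); split=> //; apply: rel_tgt.
Qed.

Definition composite : option lrule :=
  match @idP inp_ok, @idP outp_ok with
  | ReflectT okI, ReflectT okO => Some (Rule (PMorph (comp_rel_pmorph okI okO)))
  | _, _ => None
  end.

End Composite.

Lemma compositeE R1 R2 (m : pmorph (outp R2) (inp R1))
    (okI : inp_ok m) (okO : outp_ok m) :
  composite m = Some (Rule (PMorph (comp_rel_pmorph okI okO))).
Proof.
rewrite /composite; case: {-}_ / idP => [okI'|/(_ okI)//].
case: {-}_ / idP => [okO'|/(_ okO)//].
by rewrite (bool_irrelevance okI' okI) (bool_irrelevance okO' okO).
Qed.

Lemma composite_Some R1 R2 (m : pmorph (outp R2) (inp R1)) C :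
  composite m = Some C -> exists (okI : inp_ok m) (okO : outp_ok m),
    C = Rule (PMorph (comp_rel_pmorph okI okO)).
Proof.
rewrite /composite; case: {-}_ / idP => [okI|//].
case: {-}_ / idP => [okO|//] [<-].
by exists okI, okO.
Qed.

Lemma inj_surj_bij (T T' : finType) (f : T -> T') :
  injective f -> (forall y, exists x, f x = y) -> bijective f.
Proof.
move=> i s; apply: inj_card_bij => //; rewrite -(card_codom i).
by apply/subset_leq_card/subsetP => y _; apply/codomP; have [x <-] := s y; exists x.
Qed.

Section SumMap.
Variables (A A' B B' : finType) (f : A -> A') (h : B -> B').
Variables (b : {set B}) (b' : {set B'}).
Hypothesis hb : forall v, (h v \in b') = (v \in b).

Let sum_map_subproof (u : {v | v \notin b}) : h (val u) \notin b'.
Proof. by rewrite hb (valP u). Qed.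

Definition sum_map (x : A + {v | v \notin b}) : A' + {v | v \notin b'} :=
  match x with
  | inl a => inl (f a)
  | inr u => inr (Sub (h (val u)) (sum_map_subproof u))
  end.

Lemma sum_map_bij : bijective f -> bijective h -> bijective sum_map.
Proof.
move=> [f' fK f'K] [h' hK h'K]; apply: inj_surj_bij.
  move=> [x|x] [y|y] //= [e]; first by rewrite (can_inj fK e).
  by congr inr; apply/val_inj/(can_inj hK).
move=> [y|y]; first by exists (inl (f' y)); rewrite /= f'K.
have p : h' (val y) \notin b by rewrite -hb h'K (valP y).
by exists (inr (Sub (h' (val y)) p)); congr inr; apply: val_inj; rewrite /= h'K.
Qed.

End SumMap.

Section GlueIso.
Variables (G H G' H' : graph) (f : giso G G') (h : giso H H').
Variables (bV : {set vert H}) (bE : {set edge H}) (lk : {set vert H * vert G}).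
Variables (bV' : {set vert H'}) (bE' : {set edge H'}).
Variable lk' : {set vert H' * vert G'}.
Hypothesis hbV : forall v, (isoV h v \in bV') = (v \in bV).
Hypothesis hbE : forall e, (isoE h e \in bE') = (e \in bE).
Hypothesis hlk : forall v w, ((isoV h v, isoV f w) \in lk') = ((v, w) \in lk).
Hypothesis lk_fun : forall v w w', (v, w) \in lk -> (v, w') \in lk -> w = w'.

Let fV := sum_map (isoV f) hbV.
Let fE := sum_map (isoE f) hbE.

Lemma endpoint_iso v :
  endpoint bV' lk' (isoV h v) = omap fV (endpoint bV lk v).
Proof.
rewrite /endpoint; case: (boolP (v \in bV)) => hv.
  rewrite !insubF ?hbV ?hv //; case: pickP => [w' hw'|no']; case: pickP => [w hw|no] //=.
  - have [g _ gK] := isoV_bij f; move: hw'; rewrite -(gK w') hlk => hw'.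
    by rewrite (lk_fun hw hw').
  - by have [g _ gK] := isoV_bij f; have := no (g w'); rewrite -hlk gK hw'.
  - by have := no' (isoV f w); rewrite hlk hw.
have hv' : isoV h v \notin bV' by rewrite hbV.
by rewrite !insubT /=; congr (Some (inr _)); apply: val_inj.
Qed.

Lemma gsrc_iso e : gsrc bV' lk' (fE e) = omap fV (gsrc bV lk e).
Proof. by case: e => e /=; rewrite iso_src // endpoint_iso. Qed.

Lemma gtgt_iso e : gtgt bV' lk' (fE e) = omap fV (gtgt bV lk e).
Proof. by case: e => e /=; rewrite iso_tgt // endpoint_iso. Qed.

Let fV_bij : bijective fV.
Proof. by apply: sum_map_bij; apply: isoV_bij. Qed.
Let fE_bij : bijective fE.
Proof. by apply: sum_map_bij; apply: isoE_bij. Qed.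

Lemma glue_ok_iso : glue_ok bV bE lk -> glue_ok bV' bE' lk'.
Proof.
move=> /forallP ok; apply/forallP => e; have [g _ gK] := fE_bij.
rewrite -(gK e) gsrc_iso gtgt_iso; have := ok (g e).
by case: (gsrc bV lk _) => // x; case: (gtgt bV lk _).
Qed.

Lemma glue_iso ok ok' : exists k : giso (@glue _ _ bV bE lk ok) (@glue _ _ bV' bE' lk' ok'),
  isoV k =1 fV /\ isoE k =1 fE.
Proof.
have hs e : src (g := glue ok') (fE e) = fV (src (g := glue ok) e).
  by apply: Some_inj; rewrite glue_src gsrc_iso -glue_src.
have ht e : tgt (g := glue ok') (fE e) = fV (tgt (g := glue ok) e).
  by apply: Some_inj; rewrite glue_tgt gtgt_iso -glue_tgt.
exists (@mk_giso (glue ok) (glue ok') fV fE fV_bij fE_bij hs ht).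
by split; [apply: mk_gisoV | apply: mk_gisoE].
Qed.

End GlueIso.

Section RelIso.
Variables (A B C A' B' C' : finType).
Variables (f : A -> A') (g : B -> B') (h : C -> C').
Variables (r : {set A * B}) (s : {set B * C}).
Variables (r' : {set A' * B'}) (s' : {set B' * C'}).
Hypothesis hf : bijective f.
Hypothesis hg : bijective g.
Hypothesis hr : forall a b, ((f a, g b) \in r') = ((a, b) \in r).
Hypothesis hs : forall b c, ((g b, h c) \in s') = ((b, c) \in s).

Lemma rcomp_iso a c : ((f a, h c) \in rcomp r' s') = ((a, c) \in rcomp r s).
Proof.
apply/rcompP/rcompP => [[b' [h1 h2]]|[b [h1 h2]]]; last first.
  by exists (g b); rewrite hr hs.
have [k _ kK] := hg; exists (k b').
by rewrite -hr -hs kK.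
Qed.

Lemma rdom_iso a : (f a \in rdom r') = (a \in rdom r).
Proof.
apply/rdomP/rdomP => [[b' h1]|[b h1]]; last by exists (g b); rewrite hr.
by have [k _ kK] := hg; exists (k b'); rewrite -hr kK.
Qed.

Lemma rim_iso b : (g b \in rim r') = (b \in rim r).
Proof.
apply/rimP/rimP => [[a' h1]|[a h1]]; last by exists (f a); rewrite hr.
by have [k _ kK] := hf; exists (k a'); rewrite -hr kK.
Qed.

End RelIso.

Lemma comp_rel_iso (I1 O1 I2 O2 I1' O1' I2' O2' : finType)
    (r1 : {set I1 * O1}) (m : {set O2 * I1}) (r2 : {set I2 * O2})
    (r1' : {set I1' * O1'}) (m' : {set O2' * I1'}) (r2' : {set I2' * O2'})
    f1 g1 f2 g2
    (hI : forall v, (f1 v \in rim m') = (v \in rim m))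
    (hO : forall v, (g2 v \in rdom m') = (v \in rdom m)) :
  bijective f1 -> bijective g2 ->
  (forall a b, ((f1 a, g1 b) \in r1') = ((a, b) \in r1)) ->
  (forall a b, ((f2 a, g2 b) \in r2') = ((a, b) \in r2)) ->
  (forall a b, ((g2 a, f1 b) \in m') = ((a, b) \in m)) ->
  forall x y, ((sum_map f2 hI x, sum_map g1 hO y) \in comp_rel r1' m' r2')
              = ((x, y) \in comp_rel r1 m r2).
Proof.
move=> bf1 bg2 h1 h2 hm [x|x] [y|y]; rewrite !comp_relE //=.
by apply: (rcomp_iso (g := g2)) => // b c; apply: (rcomp_iso (g := f1)).
Qed.

Section CompositeIso.
Variables (R1 R2 R1' R2' : lrule).
Variables (f1 : giso (inp R1) (inp R1')) (g1 : giso (outp R1) (outp R1')).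
Variables (f2 : giso (inp R2) (inp R2')) (g2 : giso (outp R2) (outp R2')).
Hypothesis h1V : forall a b,
  ((isoV f1 a, isoV g1 b) \in relV (rel R1')) = ((a, b) \in relV (rel R1)).
Hypothesis h1E : forall a b,
  ((isoE f1 a, isoE g1 b) \in relE (rel R1')) = ((a, b) \in relE (rel R1)).
Hypothesis h2V : forall a b,
  ((isoV f2 a, isoV g2 b) \in relV (rel R2')) = ((a, b) \in relV (rel R2)).
Hypothesis h2E : forall a b,
  ((isoE f2 a, isoE g2 b) \in relE (rel R2')) = ((a, b) \in relE (rel R2)).
Variables (m : pmorph (outp R2) (inp R1)) (m' : pmorph (outp R2') (inp R1')).
Hypothesis hmV : forall a b,
  ((isoV g2 a, isoV f1 b) \in relV m') = ((a, b) \in relV m).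
Hypothesis hmE : forall a b,
  ((isoE g2 a, isoE f1 b) \in relE m') = ((a, b) \in relE m).

Lemma composite_iso C : composite m = Some C ->
  exists2 C', composite m' = Some C' & rule_iso C C'.
Proof.
case/composite_Some => okI [okO ->].
have bf1V := isoV_bij f1; have bf1E := isoE_bij f1.
have bg2V := isoV_bij g2; have bg2E := isoE_bij g2.
have hIV v : (isoV f1 v \in rim (relV m')) = (v \in rim (relV m)).
  exact: (rim_iso bg2V).
have hIE v : (isoE f1 v \in rim (relE m')) = (v \in rim (relE m)).
  exact: (rim_iso bg2E).
have hOV v : (isoV g2 v \in rdom (relV m')) = (v \in rdom (relV m)).
  exact: (rdom_iso bf1V).
have hOE v : (isoE g2 v \in rdom (relE m')) = (v \in rdom (relE m)).
  exact: (rdom_iso bf1E).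
have lkI v w : ((isoV f1 v, isoV f2 w) \in inp_link m') = ((v, w) \in inp_link m).
  by rewrite !rinvE; apply: (rcomp_iso (g := isoV g2)).
have lkO v w : ((isoV g2 v, isoV g1 w) \in outp_link m') = ((v, w) \in outp_link m).
  exact: (rcomp_iso (g := isoV f1)).
have funI v w w' : (v, w) \in inp_link m -> (v, w') \in inp_link m -> w = w'.
  rewrite !rinvE => /rcompP[b [h h']] /rcompP[c [k k']].
  by have e := relV_inj h' k'; subst c; apply: relV_inj h k.
have funO v w w' : (v, w) \in outp_link m -> (v, w') \in outp_link m -> w = w'.
  move=> /rcompP[b [h h']] /rcompP[c [k k']].
  by have e := relV_fun h k; subst c; apply: relV_fun h' k'.
have okI' : inp_ok m' := glue_ok_iso hIV hIE lkI funI okI.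
have okO' : outp_ok m' := glue_ok_iso hOV hOE lkO funO okO.
exists (Rule (PMorph (comp_rel_pmorph okI' okO'))); first exact: compositeE.
have [kI [kIV kIE]] := glue_iso hIV hIE lkI funI okI okI'.
have [kO [kOV kOE]] := glue_iso hOV hOE lkO funO okO okO'.
apply/rule_isoP; exists kI, kO; split=> a b.
  by rewrite kIV kOV; apply: comp_rel_iso.
by rewrite kIE kOE; apply: comp_rel_iso.
Qed.

End CompositeIso.

Definition R_DPO (K : fieldType) := {malg K[rclass]}.
HB.instance Definition _ K := GRing.Lmodule.on (R_DPO K).

HB.lock Definition delta (K : fieldType) (R : lrule) : R_DPO K := << cls R >>.

Section RuleAlgebra.
Variable K : fieldType.
Local Notation R_DPO := (R_DPO K).
Local Notation delta := (delta K).

Definition r_empty : R_DPO := delta empty_rule.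

Definition comp_sum (R1 R2 : lrule) : R_DPO :=
  \sum_(m : pmorph (outp R2) (inp R1))
     if composite m is Some R then delta R else 0.

Lemma delta_eq R S : rule_iso R S -> delta R = delta S.
Proof. by rewrite -cls_eq => /eqP e; rewrite delta.unlock e. Qed.

Lemma comp_sum_iso R1 R2 R1' R2' : rule_iso R1 R1' -> rule_iso R2 R2' ->
  comp_sum R1 R2 = comp_sum R1' R2'.
Proof.
move=> /rule_isoP[f1 [g1 [h1V h1E]]] /rule_isoP[f2 [g2 [h2V h2E]]].
have [f1' [f1VK f1VK' f1EK f1EK']] := giso_inv f1.
have [g1' [g1VK g1VK' g1EK g1EK']] := giso_inv g1.
have [f2' [f2VK f2VK' f2EK f2EK']] := giso_inv f2.
have [g2' [g2VK g2VK' g2EK g2EK']] := giso_inv g2.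
rewrite /comp_sum [RHS](reindex_onto (transport g2 f1) (transport g2' f1')) /=; last first.
  move=> m _; apply: pmorph_eq; apply/setP => -[a b].
    by rewrite -[in LHS](g2VK' a) -[in LHS](f1VK' b) !transportV.
  by rewrite -[in LHS](g2EK' a) -[in LHS](f1EK' b) !transportE.
apply: eq_big => [m|m _].
  apply/esym/eqP; apply: pmorph_eq; apply/setP => -[a b].
    by rewrite -[in LHS](g2VK a) -[in LHS](f1VK b) !transportV.
  by rewrite -[in LHS](g2EK a) -[in LHS](f1EK b) !transportE.
set m' := transport g2 f1 m.
case e: (composite m) => [C|].
  have [C' -> iC] := composite_iso h1V h1E h2V h2E
    (transportV g2 f1 m) (transportE g2 f1 m) e.
  exact: delta_eq.
case e': (composite m') => [C'|//].
have [] // := @composite_iso R1' R2' R1 R2 f1' g1' f2' g2' _ _ _ _ m' m _ _ C' e'.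
- by move=> a b; rewrite -h1V f1VK' g1VK'.
- by move=> a b; rewrite -h1E f1EK' g1EK'.
- by move=> a b; rewrite -h2V f2VK' g2VK'.
- by move=> a b; rewrite -h2E f2EK' g2EK'.
- by move=> a b; rewrite -(transportV g2 f1) g2VK' f1VK'.
- by move=> a b; rewrite -(transportE g2 f1) g2EK' f1EK'.
by rewrite e.
Qed.

(* The bilinear extension of comp_sum, which by comp_sum_iso does not depend
   on the chosen representatives; see also rmul_delta. *)
Definition rmul (x y : R_DPO) : R_DPO :=
  \sum_(a <- msupp x) \sum_(b <- msupp y)
     (x@_a * y@_b) *: comp_sum (repr_rule a) (repr_rule b).

Lemma msupp_delta R : msupp (delta R) = [fset cls R]%fset.
Proof. by rewrite delta.unlock (@msuppU rclass K) oner_eq0. Qed.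

Lemma mcoeff_delta R : (delta R)@_(cls R) = 1.
Proof. rewrite delta.unlock; exact: (@mcoeffUU rclass K). Qed.

Lemma rmul_delta R1 R2 : rmul (delta R1) (delta R2) = comp_sum R1 R2.
Proof.
rewrite /rmul !msupp_delta !(@big_seq_fset1 R_DPO).
rewrite !mcoeff_delta mulr1 scale1r.
by apply: comp_sum_iso; rewrite rule_iso_sym repr_clsP.
Qed.

Lemma rmulEw (d d' : {fset rclass}) x y :
  (msupp x `<=` d)%fset -> (msupp y `<=` d')%fset ->
  rmul x y = \sum_(a <- d) \sum_(b <- d')
     (x@_a * y@_b) *: comp_sum (repr_rule a) (repr_rule b).
Proof.
move=> sd sd'; rewrite /rmul (big_fset_incl _ sd) /=; last first.
  move=> a _ /mcoeff_outdom ->.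
  by rewrite big1 // => b _; rewrite mul0r scale0r.
apply: eq_bigr => a _; apply: (big_fset_incl _ sd') => b _ /mcoeff_outdom ->.
by rewrite mulr0 scale0r.
Qed.

Lemma rmul_linearl c x y z : rmul (c *: x + y) z = c *: rmul x z + rmul y z.
Proof.
pose d := (msupp x `|` msupp y `|` msupp (c *: x + y))%fset.
have dx : (msupp x `<=` d)%fset by rewrite /d -fsetUA fsubsetUl.
have dy : (msupp y `<=` d)%fset by rewrite /d fsubsetU // fsubsetUr.
have dz : (msupp (c *: x + y) `<=` d)%fset by rewrite fsubsetUr.
rewrite !(@rmulEw d (msupp z)) //.
rewrite scaler_sumr -big_split; apply: eq_bigr => a _ /=.
rewrite scaler_sumr -big_split; apply: eq_bigr => b _ /=.
by rewrite mcoeffD mcoeffZ scalerA mulrA -scalerDl mulrDl.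
Qed.

Lemma rmul_linearr c x y z : rmul z (c *: x + y) = c *: rmul z x + rmul z y.
Proof.
pose d := (msupp x `|` msupp y `|` msupp (c *: x + y))%fset.
have dx : (msupp x `<=` d)%fset by rewrite /d -fsetUA fsubsetUl.
have dy : (msupp y `<=` d)%fset by rewrite /d fsubsetU // fsubsetUr.
have dz : (msupp (c *: x + y) `<=` d)%fset by rewrite fsubsetUr.
rewrite !(@rmulEw (msupp z) d) //.
rewrite scaler_sumr -big_split; apply: eq_bigr => a _ /=.
rewrite scaler_sumr -big_split; apply: eq_bigr => b _ /=.
by rewrite mcoeffD mcoeffZ scalerA mulrCA -scalerDl mulrDr.
Qed.

Definition lin_span (S : R_DPO -> Prop) (x : R_DPO) : Prop :=
  exists (n : nat) (c : 'I_n -> K) (v : 'I_n -> R_DPO),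
    (forall i, S (v i)) /\ x = \sum_(i < n) c i *: v i.

Lemma lin_span_gen (S : R_DPO -> Prop) x : S x -> lin_span S x.
Proof. by move=> Sx; exists 1, (fun=> 1), (fun=> x); rewrite big_ord1 scale1r. Qed.

Record subalgebra (A : R_DPO -> Prop) : Prop := Subalgebra {
  subalg_unit : A r_empty;
  subalg_lin : forall (c : K) x y, A x -> A y -> A (c *: x + y);
  subalg_mul : forall x y, A x -> A y -> A (rmul x y) }.

Definition O_gen (x : R_DPO) : Prop :=
  exists (O O' : graph) (r : pmorph O O'),
    [/\ #|vert O| = #|vert O'|, #|edge O| = #|edge O'| & x = delta (Rule r)].

(* Up to isomorphism of rules, O' = O and r is contained in id_O. *)
Definition sub_id (O O' : graph) (r : pmorph O O') : Prop :=
  exists (P : graph) (q : pmorph P P),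
    [/\ rule_iso (Rule r) (Rule q),
        relV q \subset idrel (vert P) & relE q \subset idrel (edge P)].

Definition D_gen (x : R_DPO) : Prop :=
  exists (O O' : graph) (r : pmorph O O'),
    [/\ #|vert O| = #|vert O'| /\ #|edge O| = #|edge O'|,
        isomorphic O O', sub_id r & x = delta (Rule r)].

End RuleAlgebra.

(* Main.v *)
Require Import Defs.
From mathcomp Require Import all_boot all_order all_algebra.

(* The interfaces of a composite have the sizes |I2| + |I1| - |m| and
   |O1| + |O2| - |m|, which gives (i).

   If r1 and r2 are partial identities, both interfaces of a composite are the
   gluing of the two graphs along m, and the composite relation is contained in
   the canonical bijection between them; hence (ii) describes a subalgebra.
   Reversing rules is an anti-involution: the reversal of the composite of R1
   and R2 along m is the composite of the reversals of R2 and R1 along the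
   inverse of m. A rule contained in the identity is its own reversal, so the
   products in both orders agree composite by composite. *)

Set Implicit Arguments.
Unset Strict Implicit.
Unset Printing Implicit Defensive.

Import GRing.Theory.

(** * Linear spans and bilinearity of the product *)

Lemma lin_span_ind (K : fieldType) (S P : R_DPO K -> Prop) :
  P 0%R -> (forall (c : K) x y, S x -> P y -> P (c *: x + y)%R) ->
  forall x, lin_span S x -> P x.
Proof.
move=> P0 PD _ [n [c [v [Sv ->]]]].
elim: n c v Sv => [|n IH] c v Sv; first by rewrite big_ord0.
by rewrite big_ord_recl; apply: PD => //; apply: IH.
Qed.

Lemma lin_span0 (K : fieldType) (S : R_DPO K -> Prop) : lin_span S 0%R.
Proof.
exists 0, (fun=> 0%R), (fun=> 0%R); split; first by case.
by rewrite big_ord0.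
Qed.

Lemma lin_spanDgen (K : fieldType) (S : R_DPO K -> Prop) (c : K) x y :
  S x -> lin_span S y -> lin_span S (c *: x + y)%R.
Proof.
move=> Sx [n [d [v [Sv ->]]]].
(* Index 0 carries the new term; [unlift ord0] sends every other index back to the old sum. *)
exists n.+1, (fun i => oapp d c (unlift ord0 i)),
  (fun i => oapp v x (unlift ord0 i)); split.
  by move=> i; case: unliftP => [j|] _ /=.
rewrite big_ord_recl unlift_none /=; congr (_ + _)%R.
by apply: eq_bigr => i _; rewrite liftK.
Qed.

Lemma lin_span_lin (K : fieldType) (S : R_DPO K -> Prop) (c : K) x y :
  lin_span S x -> lin_span S y -> lin_span S (c *: x + y)%R.
Proof.
move=> Sx Sy; elim/lin_span_ind: Sx => [|d z w Sz IH].
  by rewrite scaler0 add0r.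
by rewrite scalerDr scalerA -addrA; apply: lin_spanDgen.
Qed.

Lemma lin_span_sum (K : fieldType) (S : R_DPO K -> Prop) (I : finType)
    (F : I -> R_DPO K) :
  (forall i, lin_span S (F i)) -> lin_span S (\sum_i F i)%R.
Proof.
move=> SF; apply: big_ind => [|x y Sx Sy|i _]; [exact: lin_span0| |exact: SF].
by rewrite -[x]scale1r; apply: lin_span_lin.
Qed.

Lemma lin_span_sub (K : fieldType) (S T : R_DPO K -> Prop) :
  (forall x, S x -> T x) -> forall x, lin_span S x -> lin_span T x.
Proof.
move=> ST x [n [c [v [Sv ->]]]]; exists n, c, v.
by split=> // i; apply/ST/Sv.
Qed.

Lemma rmul0l (K : fieldType) (x : R_DPO K) : rmul 0%R x = 0%R.
Proof.
(* Writing 0 as [-1 *: 0 + 0] equates the product with its own negative plus itself, which is 0. *)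
have := rmul_linearl (-1)%R 0%R 0%R x.
by rewrite scaler0 addr0 scaleN1r addNr.
Qed.

Lemma rmul0r (K : fieldType) (x : R_DPO K) : rmul x 0%R = 0%R.
Proof.
have := rmul_linearr (-1)%R 0%R 0%R x.
by rewrite scaler0 addr0 scaleN1r addNr.
Qed.

Lemma lin_span_mul (K : fieldType) (S : R_DPO K -> Prop) :
  (forall x y, S x -> S y -> lin_span S (rmul x y)) ->
  forall x y, lin_span S x -> lin_span S y -> lin_span S (rmul x y).
Proof.
move=> SM x y Sx Sy; elim/lin_span_ind: Sx => [|c x' z Sx' IH].
  by rewrite rmul0l; apply: lin_span0.
rewrite rmul_linearl; apply: lin_span_lin => //.
elim/lin_span_ind: Sy {IH} => [|d y' w Sy' IH].
  by rewrite rmul0r; apply: lin_span0.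
by rewrite rmul_linearr; apply: lin_span_lin => //; apply: SM.
Qed.

Lemma lin_span_comm (K : fieldType) (S : R_DPO K -> Prop) :
  (forall x y, S x -> S y -> rmul x y = rmul y x) ->
  forall x y, lin_span S x -> lin_span S y -> rmul x y = rmul y x.
Proof.
(* No rewriting here: matching rmul against a variable and a sum makes
   unification unfold the monoid algebra. *)
move=> SC x y Sx Sy; elim/lin_span_ind: Sx => [|c x' z Sx' IH].
  exact: etrans (rmul0l y) (esym (rmul0r y)).
apply: etrans (rmul_linearl c x' z y) (etrans _ (esym (rmul_linearr c x' z y))).
apply: (f_equal2 (fun a b => c *: a + b)%R _ IH) => {z c IH}.
elim/lin_span_ind: Sy => [|d y' w Sy' IH].
  exact: etrans (rmul0r x') (esym (rmul0l x')).
apply: etrans (rmul_linearr d y' w x') (etrans _ (esym (rmul_linearl d y' w x'))).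
exact: (f_equal2 (fun a b => d *: a + b)%R (SC _ _ Sx' Sy') IH).
Qed.

(** By bilinearity only products of generators matter, and these are sums of composites. [Q] allows
    a convenient representative of each factor, while a composite only has to yield a generator
    again. *)
Lemma lin_span_subalgebra (K : fieldType) (S : R_DPO K -> Prop)
    (Q : lrule -> Prop) :
  S (r_empty K) -> (forall x, S x -> exists2 R, Q R & x = delta K R) ->
  (forall R1 R2 (m : pmorph (outp R2) (inp R1)) C, Q R1 -> Q R2 ->
     composite m = Some C -> S (delta K C)) ->
  subalgebra (lin_span S).
Proof.
move=> S1 SQ QM; split; [exact: lin_span_gen|exact: lin_span_lin|].
apply: lin_span_mul => x y /SQ[R1 Q1 ->] /SQ[R2 Q2 ->].
rewrite rmul_delta; apply: lin_span_sum => m.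
case e: (composite m) => [C|]; last exact: lin_span0.
by apply: lin_span_gen; apply: QM Q1 Q2 e.
Qed.

(** * Sizes of the interfaces of a composite *)

Lemma card_rdom_rim (A B : finType) (r : {set A * B}) :
  one_to_one r -> #|rdom r| = #|rim r|.
Proof.
move=> /one_to_oneP[f i].
rewrite !card_in_imset // => -[a b] [a' b'] h h' /= e; subst.
  by rewrite (i _ _ _ h h').
by rewrite (f _ _ _ h h').
Qed.

Lemma card_sum_notin (A B : finType) (X : {set B}) :
  #|{: A + {x | x \notin X}}| + #|X| = #|A| + #|B|.
Proof.
rewrite card_sum -addnA card_sig; congr (_ + _).
rewrite -[RHS](cardsC X) addnC; congr (_ + _).
by apply: eq_card => x; rewrite !inE.
Qed.

Lemma one_to_one_relV (G H : graph) (m : pmorph G H) : one_to_one (relV m).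
Proof. by have /and3P[] := valP m. Qed.

Lemma one_to_one_relE (G H : graph) (m : pmorph G H) : one_to_one (relE m).
Proof. by have /and3P[] := valP m. Qed.

(** The input loses the image of [m] and the output its domain, which are equally large because [m]
    is one-to-one. The additive form avoids truncated subtraction. *)
Lemma composite_card (R1 R2 : lrule) (m : pmorph (outp R2) (inp R1)) C :
  composite m = Some C ->
  [/\ #|vert (inp C)| + #|rim (relV m)| = #|vert (inp R2)| + #|vert (inp R1)|,
      #|edge (inp C)| + #|rim (relE m)| = #|edge (inp R2)| + #|edge (inp R1)|,
      #|vert (outp C)| + #|rim (relV m)| = #|vert (outp R1)| + #|vert (outp R2)|
    & #|edge (outp C)| + #|rim (relE m)| = #|edge (outp R1)| + #|edge (outp R2)|].
Proof.
move=> /composite_Some[okI [okO ->]]; split; try exact: card_sum_notin.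
  by rewrite -card_rdom_rim ?one_to_one_relV // card_sum_notin.
by rewrite -card_rdom_rim ?one_to_one_relE // card_sum_notin.
Qed.

(** * Identifying the two gluings along a match *)

Lemma bij_of_rel (A B : finType) (r : {set A * B}) :
  one_to_one r -> (forall a, exists b, (a, b) \in r) ->
  (forall b, exists a, (a, b) \in r) ->
  exists2 f : A -> B, bijective f & forall a b, ((a, b) \in r) = (b == f a).
Proof.
move=> /one_to_oneP[rf ri] tot sur.
pose f a := xchoose (tot a); have fP a : (a, f a) \in r by exact: (xchooseP (tot a)).
exists f => [|a b].
  apply: inj_surj_bij => [a a' e|b]; first by apply: (ri _ _ (f a)); rewrite // e.
  by have [a h] := sur b; exists a; apply: rf (fP a) h.
by apply/idP/eqP => [h|->//]; apply: rf h (fP a).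
Qed.

Lemma idrelE (A : finType) (a b : A) : ((a, b) \in idrel A) = (a == b).
Proof. by rewrite inE. Qed.

(* The canonical identification of A2 + (A1 \ rim m) with A1 + (A2 \ rdom m),
   both being the pushout of A2 and A1 along m. *)
Definition glue_rel (A1 A2 : finType) (m : {set A2 * A1}) :=
  comp_rel (idrel A1) m (idrel A2).

Lemma glue_relE (A1 A2 : finType) (m : {set A2 * A1})
    (x : A2 + {x | x \notin rim m}) (y : A1 + {y | y \notin rdom m}) :
  ((x, y) \in glue_rel m) =
  match x, y with
  | inl x, inl y => (x, y) \in m
  | inl x, inr y => x == val y
  | inr x, inl y => val x == y
  | inr _, inr _ => false
  end.
Proof.
rewrite comp_relE; case: x y => x [y|y] //; try exact: idrelE.
apply/rcompP/idP => [[a []]|h].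
  rewrite idrelE => /eqP <- /rcompP[b [h]].
  by rewrite idrelE => /eqP <-.
exists x; rewrite idrelE eqxx; split=> //.
by apply/rcompP; exists y; rewrite idrelE eqxx.
Qed.

(** An element kept on one side is either matched, and corresponds to its partner, or unmatched, and
    survives as itself on the other side. *)
Lemma glue_rel_bij (A1 A2 : finType) (m : {set A2 * A1}) : one_to_one m ->
  exists2 f, bijective f & forall x y, ((x, y) \in glue_rel m) = (y == f x).
Proof.
have id1 (A : finType) : one_to_one (idrel A).
  by apply/one_to_oneP; split=> ? ? ?; rewrite !idrelE => /eqP-> /eqP.
move=> hm; apply: bij_of_rel; first exact: comp_rel_1to1.
- case=> [a|u]; last by exists (inl (val u)); rewrite glue_relE.
  have [/rdomP[b h]|h] := boolP (a \in rdom m).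
    by exists (inl b); rewrite glue_relE.
  by exists (inr (exist _ a h)); rewrite glue_relE.
- case=> [b|u]; last by exists (inl (val u)); rewrite glue_relE.
  have [/rimP[a h]|h] := boolP (b \in rim m).
    by exists (inl a); rewrite glue_relE.
  by exists (inr (exist _ b h)); rewrite glue_relE.
Qed.

(** [comp_rel] is monotone in both rules, and [glue_rel] is its value at the full identities. *)
Lemma comp_rel_sub_glue (A1 A2 : finType) (r1 : {set A1 * A1})
    (m : {set A2 * A1}) (r2 : {set A2 * A2}) x y :
  r1 \subset idrel A1 -> r2 \subset idrel A2 ->
  (x, y) \in comp_rel r1 m r2 -> (x, y) \in glue_rel m.
Proof.
move=> /subsetP s1 /subsetP s2; rewrite comp_relE glue_relE.
case: x y => x [y|y] //.
- move=> /rcompP[a [/s2]]; rewrite idrelE => /eqP <- /rcompP[b [h /s1]].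
  by rewrite idrelE => /eqP <-.
- by move=> /s2; rewrite idrelE.
- by move=> /s1; rewrite idrelE.
Qed.

(** The links may be smaller than the match, since rules can delete vertices. But [glue_ok] excludes
    missing endpoints, and a redirected endpoint is always the partner under [m], so the canonical
    bijections respect sources and targets. *)
Lemma glue_swap_iso (G1 G2 : graph) (m : pmorph G2 G1)
    (lkI : {set vert G1 * vert G2}) (lkO : {set vert G2 * vert G1})
    (okI : glue_ok (rim (relV m)) (rim (relE m)) lkI)
    (okO : glue_ok (rdom (relV m)) (rdom (relE m)) lkO) :
  lkI \subset rinv (relV m) -> lkO \subset relV m ->
  exists f : giso (glue okI) (glue okO),
    (forall x y, ((x, y) \in glue_rel (relV m)) = (y == isoV f x)) /\
    (forall x y, ((x, y) \in glue_rel (relE m)) = (y == isoE f x)).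
Proof.
move=> /subsetP sI /subsetP sO.
have [fV bV fVE] := glue_rel_bij (one_to_one_relV m).
have [fE bE fEE] := glue_rel_bij (one_to_one_relE m).
(* Redirected or not, the endpoint of a surviving edge corresponds to the original vertex, which the
   other gluing keeps. *)
have endI v (z : vert (glue okI)) : Some z = endpoint (rim (relV m)) lkI v ->
    (z, inl v) \in glue_rel (relV m).
  rewrite glue_relE => /endpointP; case: z => [w /sI|u ->] //.
  by rewrite rinvE.
have endO v (z : vert (glue okO)) : Some z = endpoint (rdom (relV m)) lkO v ->
    (inl v, z) \in glue_rel (relV m).
  by rewrite glue_relE => /endpointP; case: z => [w /sO|u ->].
have ends (x : edge (glue okI)) :
    (src x, src (g := glue okO) (fE x)) \in glue_rel (relV m) /\
    (tgt x, tgt (g := glue okO) (fE x)) \in glue_rel (relV m).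
  have : (x, fE x) \in glue_rel (relE m) by rewrite fEE.
  move: (fE x) => y.
  move: (@glue_src _ _ _ _ _ okI x) (@glue_tgt _ _ _ _ _ okI x)
        (@glue_src _ _ _ _ _ okO y) (@glue_tgt _ _ _ _ _ okO y).
  move: (src x) (tgt x) (src (g := glue okO) y) (tgt (g := glue okO) y).
  move=> sx tx sy ty; rewrite glue_relE.
  case: x y => x [y|y] //=.
  - by move=> [->] [->] [->] [->] h; rewrite !glue_relE rel_src // rel_tgt.
  - by move=> [->] [->] hs ht /eqP e; subst x; split; apply: endO.
  - by move=> hs ht [->] [->] /eqP e; subst y; split; apply: endI.
have hs x : src (g := glue okO) (fE x) = fV (src (g := glue okI) x).
  by apply/eqP; rewrite -fVE; case: (ends x).
have ht x : tgt (g := glue okO) (fE x) = fV (tgt (g := glue okI) x).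
  by apply/eqP; rewrite -fVE; case: (ends x).
exists (@mk_giso (glue okI) (glue okO) fV fE bV bE hs ht).
by split=> x y; rewrite (mk_gisoV, mk_gisoE).
Qed.

(** Transporting the output along the inverse of [f] gives an isomorphic rule from [G] to [G], in
    which the pairs [(x, f x)] become diagonal. *)
Lemma sub_id_giso (G H : graph) (r : pmorph G H) (f : giso G H) :
  (forall x y, (x, y) \in relV r -> y = isoV f x) ->
  (forall x y, (x, y) \in relE r -> y = isoE f x) -> sub_id r.
Proof.
move=> rV rE; have [i [iV iE]] := giso_id G.
have [g [gV gVK gE gEK]] := giso_inv f.
exists G, (transport i g r); split.
- by apply/rule_isoP; exists i, g; split=> a b; rewrite (transportV, transportE).
- apply/subsetP => -[a b]; rewrite -[a]iV -[b]gV transportV idrelE iV.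
  by move/rV/(congr1 (isoV g)); rewrite !gV => ->.
- apply/subsetP => -[a b]; rewrite -[a]iE -[b]gE transportE idrelE iE.
  by move/rE/(congr1 (isoE g)); rewrite !gE => ->.
Qed.

(** * Reversal of rules and of composites *)

Lemma rev_subproof (G H : graph) (m : pmorph G H) :
  @is_pmorph H G (rinv (relV m), rinv (relE m)).
Proof.
apply/and3P; split=> /=.
- apply/one_to_oneP; split=> a b c; rewrite !rinvE.
    exact: relV_inj.
  exact: relV_fun.
- apply/one_to_oneP; split=> a b c; rewrite !rinvE.
    exact: relE_inj.
  exact: relE_fun.
- apply/forall_inP => -[a b]; rewrite rinvE => h.
  by rewrite !rinvE rel_src ?rel_tgt.
Qed.

Definition pmorph_rev (G H : graph) (m : pmorph G H) : pmorph H G :=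
  PMorph (rev_subproof m).

Definition rule_rev (R : lrule) : lrule := Rule (pmorph_rev (Defs.rel R)).

Lemma relV_rev (G H : graph) (m : pmorph G H) a b :
  ((b, a) \in relV (pmorph_rev m)) = ((a, b) \in relV m).
Proof. exact: rinvE. Qed.

Lemma relE_rev (G H : graph) (m : pmorph G H) a b :
  ((b, a) \in relE (pmorph_rev m)) = ((a, b) \in relE m).
Proof. exact: rinvE. Qed.

Lemma pmorph_revK (G H : graph) : cancel (@pmorph_rev G H) (@pmorph_rev H G).
Proof.
by move=> m; apply: pmorph_eq; apply/setP => -[a b]; rewrite !(relV_rev, relE_rev).
Qed.

Lemma rim_rinv (A B : finType) (r : {set A * B}) : rim (rinv r) = rdom r.
Proof.
apply/setP => a; apply/rimP/rdomP => -[b]; first by rewrite rinvE; exists b.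
by exists b; rewrite rinvE.
Qed.

Lemma rdom_rinv (A B : finType) (r : {set A * B}) : rdom (rinv r) = rim r.
Proof.
apply/setP => a; apply/rdomP/rimP => -[b]; first by rewrite rinvE; exists b.
by exists b; rewrite rinvE.
Qed.

Lemma rinvK (A B : finType) (r : {set A * B}) : rinv (rinv r) = r.
Proof. by apply/setP => -[a b]; rewrite !rinvE. Qed.

Lemma rinv_rcomp (A B C : finType) (r : {set A * B}) (s : {set B * C}) :
  rinv (rcomp r s) = rcomp (rinv s) (rinv r).
Proof.
apply/setP => -[c a]; rewrite rinvE.
by apply/rcompP/rcompP => -[b [h h']]; exists b; rewrite !rinvE in h h' *.
Qed.

Lemma rcompA (A B C D : finType) (r : {set A * B}) (s : {set B * C})
    (t : {set C * D}) :
  rcomp r (rcomp s t) = rcomp (rcomp r s) t.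
Proof.
apply/setP => -[a d]; apply/rcompP/rcompP.
  move=> [b [h /rcompP[c [h' h'']]]]; exists c; split=> //.
  by apply/rcompP; exists b.
move=> [c [/rcompP[b [h h']] h'']]; exists b; split=> //.
by apply/rcompP; exists c.
Qed.

Lemma rinv_rcomp3 (A B C D : finType) (r : {set A * B}) (s : {set B * C})
    (t : {set C * D}) :
  rcomp (rinv t) (rcomp (rinv s) (rinv r)) = rinv (rcomp r (rcomp s t)).
Proof. by rewrite rcompA !rinv_rcomp. Qed.

Section CompositeRev.
Variables (R1 R2 : lrule) (m : pmorph (outp R2) (inp R1)).

Let m' : pmorph (outp (rule_rev R1)) (inp (rule_rev R2)) := pmorph_rev m.

Lemma inp_link_rev : inp_link m' = outp_link m.
Proof.
by rewrite /inp_link rinv_rcomp; congr rcomp; apply: rinvK.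
Qed.

Lemma outp_link_rev : outp_link m' = inp_link m.
Proof. by rewrite /inp_link rinv_rcomp. Qed.

Lemma inp_ok_rev : inp_ok m' = outp_ok m.
Proof. by rewrite /inp_ok inp_link_rev !rim_rinv. Qed.

Lemma outp_ok_rev : outp_ok m' = inp_ok m.
Proof. by rewrite /outp_ok outp_link_rev !rdom_rinv. Qed.

(** Reversal exchanges the two links and the two sets of matched elements, so the interfaces trade
    places. This holds up to isomorphism: [rim] of the inverse and [rdom] of [m] are only provably
    equal, so the surviving parts are distinct subtypes. *)
Lemma composite_rev C : composite m = Some C ->
  exists2 C', composite m' = Some C' & rule_iso (rule_rev C) C'.
Proof.
move=> /composite_Some[okI [okO ->]].
have okI' : inp_ok m' by rewrite inp_ok_rev.
have okO' : outp_ok m' by rewrite outp_ok_rev.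
exists (Rule (PMorph (comp_rel_pmorph okI' okO'))); first exact: compositeE.
(* With identity isomorphisms, [glue_iso] carries a gluing over to equal sets and links. *)
have [i1 [i1V i1E]] := giso_id (inp R1); have [i2 [i2V i2E]] := giso_id (inp R2).
have [o1 [o1V o1E]] := giso_id (outp R1).
have [o2 [o2V o2E]] := giso_id (outp R2).
have hIV v : (isoV o2 v \in rim (relV m')) = (v \in rdom (relV m)).
  by rewrite o2V rim_rinv.
have hIE v : (isoE o2 v \in rim (relE m')) = (v \in rdom (relE m)).
  by rewrite o2E rim_rinv.
have hOV v : (isoV i1 v \in rdom (relV m')) = (v \in rim (relV m)).
  by rewrite i1V rdom_rinv.
have hOE v : (isoE i1 v \in rdom (relE m')) = (v \in rim (relE m)).
  by rewrite i1E rdom_rinv.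
have lkI v w : ((isoV o2 v, isoV o1 w) \in inp_link m') = ((v, w) \in outp_link m).
  by rewrite o2V o1V inp_link_rev.
have lkO v w : ((isoV i1 v, isoV i2 w) \in outp_link m') = ((v, w) \in inp_link m).
  by rewrite i1V i2V outp_link_rev.
have funI v w w' : (v, w) \in inp_link m -> (v, w') \in inp_link m -> w = w'.
  rewrite !rinvE => /rcompP[b [h h']] /rcompP[c [k k']].
  by have e := relV_inj h' k'; subst c; apply: relV_inj h k.
have funO v w w' : (v, w) \in outp_link m -> (v, w') \in outp_link m -> w = w'.
  move=> /rcompP[b [h h']] /rcompP[c [k k']].
  by have e := relV_fun h k; subst c; apply: relV_fun h' k'.
have [kI [kIV kIE]] := glue_iso hIV hIE lkI funO okO okI'.
have [kO [kOV kOE]] := glue_iso hOV hOE lkO funI okI okO'.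
apply/rule_isoP; exists kI, kO; split=> a b.
  rewrite kIV kOV relV_rev /relV !comp_relE.
  by case: a b => a [b|b] //=; rewrite ?o1V ?i2V ?o2V ?i1V ?rinv_rcomp3 ?rinvE.
rewrite kIE kOE relE_rev /relE !comp_relE.
by case: a b => a [b|b] //=; rewrite ?o1E ?i2E ?o2E ?i1E ?rinv_rcomp3 ?rinvE.
Qed.

Lemma composite_rev_None : composite m = None -> composite m' = None.
Proof.
move=> e; case e': (composite m') => [C'|//].
have [okI' [okO' _]] := composite_Some e'.
have okI : inp_ok m by rewrite -outp_ok_rev.
have okO : outp_ok m by rewrite -inp_ok_rev.
by rewrite (compositeE okI okO) in e.
Qed.

End CompositeRev.

(** Inverting matches is a bijection of the index sets, and it preserves which composites vanish. *)
Lemma comp_sum_rev (K : fieldType) (R1 R2 : lrule) :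
  comp_sum K (rule_rev R2) (rule_rev R1) =
  (\sum_(m : pmorph (outp R2) (inp R1))
     if composite m is Some C then delta K (rule_rev C) else 0)%R.
Proof.
rewrite /comp_sum (reindex_onto (@pmorph_rev _ _) (@pmorph_rev _ _)) /=; last first.
  by move=> m _; apply: pmorph_revK.
apply: eq_big => [m|m _]; first by apply/eqP/pmorph_revK.
case e: (composite m) => [C|].
  by have [C' -> i] := composite_rev e; apply/esym/delta_eq.
by rewrite (composite_rev_None e).
Qed.

Lemma rule_iso_rev (R S : lrule) :
  rule_iso R S -> rule_iso (rule_rev R) (rule_rev S).
Proof.
move=> /rule_isoP[f [g [hV hE]]]; apply/rule_isoP; exists g, f.
by split=> a b; rewrite (relV_rev, relE_rev) (hV, hE) (relV_rev, relE_rev).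
Qed.

(** A subset of the diagonal is symmetric, so the representative [q] equals its own reversal. *)
Lemma sub_id_rev (G H : graph) (r : pmorph G H) :
  sub_id r -> rule_iso (rule_rev (Rule r)) (Rule r).
Proof.
move=> [P [q [i /subsetP sV /subsetP sE]]].
apply: (rule_iso_trans (rule_iso_rev i)); rewrite rule_iso_sym.
suff -> : rule_rev (Rule q) = Rule q by [].
have rinv_sub (T : finType) (t : {set T * T}) :
    {subset t <= idrel T} -> rinv t = t.
  move=> st; apply/setP => -[a b]; rewrite rinvE.
  by apply/idP/idP => h; have := st _ h; rewrite idrelE => /eqP e; rewrite e in h *.
by congr Rule; apply: pmorph_eq; apply: rinv_sub.
Qed.

(** * Generators of the two algebras and their composites *)

Lemma composite_sub_id (P1 P2 : graph) (q1 : pmorph P1 P1) (q2 : pmorph P2 P2)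
    (m : pmorph P2 P1) C :
  relV q1 \subset idrel (vert P1) -> relE q1 \subset idrel (edge P1) ->
  relV q2 \subset idrel (vert P2) -> relE q2 \subset idrel (edge P2) ->
  composite (R1 := Rule q1) (R2 := Rule q2) m = Some C ->
  isomorphic (inp C) (outp C) /\ sub_id (Defs.rel C).
Proof.
move=> s1V s1E s2V s2E /composite_Some[okI [okO ->]] /=.
(* A partial identity moves no vertex, so the links lie in the match or its inverse, as
   [glue_swap_iso] requires. *)
have sI : inp_link (R1 := Rule q1) (R2 := Rule q2) m \subset rinv (relV m).
  apply/subsetP => -[b a]; rewrite !rinvE => /rcompP[c [/(subsetP s2V)]].
  by rewrite idrelE => /eqP <-.
have sO : outp_link (R1 := Rule q1) (R2 := Rule q2) m \subset relV m.
  apply/subsetP => -[a b] /rcompP[c [h /(subsetP s1V)]].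
  by rewrite idrelE => /eqP <-.
have [f [fV fE]] := glue_swap_iso okI okO sI sO.
split; first exact: (inhabits f).
apply: (sub_id_giso (f := f)) => x y h; apply/eqP.
  by rewrite -fV; apply: comp_rel_sub_glue h.
by rewrite -fE; apply: comp_rel_sub_glue h.
Qed.

Lemma isomorphic_card (G H : graph) :
  isomorphic G H -> #|vert G| = #|vert H| /\ #|edge G| = #|edge H|.
Proof.
by case=> f; split; apply: bij_eq_card; [apply: isoV_bij f|apply: isoE_bij f].
Qed.

Definition card_preserving (R : lrule) : Prop :=
  #|vert (inp R)| = #|vert (outp R)| /\ #|edge (inp R)| = #|edge (outp R)|.

Lemma composite_card_preserving (R1 R2 : lrule)
    (m : pmorph (outp R2) (inp R1)) C :
  card_preserving R1 -> card_preserving R2 -> composite m = Some C ->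
  card_preserving C.
Proof.
move=> [V1 E1] [V2 E2] /composite_card[Vi Ei Vo Eo]; split.
  by apply: (@addIn #|rim (relV m)|); rewrite Vi Vo V1 V2 addnC.
by apply: (@addIn #|rim (relE m)|); rewrite Ei Eo E1 E2 addnC.
Qed.

Lemma O_genP (K : fieldType) (x : R_DPO K) :
  O_gen x <-> exists2 R, card_preserving R & x = delta K R.
Proof.
split=> [[G [H [r [hV hE ->]]]]|[[G H r] [hV hE] ->]]; first by exists (Rule r).
by exists G, H, r.
Qed.

Definition sub_id_rule (R : lrule) : Prop :=
  isomorphic (inp R) (outp R) /\ sub_id (Defs.rel R).

Lemma D_gen_rule (K : fieldType) (R : lrule) :
  sub_id_rule R -> D_gen (delta K R).
Proof.
case: R => G H r [i s]; exists G, H, r.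
by split=> //; apply: isomorphic_card.
Qed.

(** [delta] sees only the isomorphism class, so the two interfaces may be taken literally equal. *)
Lemma D_gen_normal (K : fieldType) (x : R_DPO K) : D_gen x ->
  exists (P : graph) (q : pmorph P P),
    [/\ relV q \subset idrel (vert P), relE q \subset idrel (edge P)
      & x = delta K (Rule q)].
Proof.
move=> [G [H [r [_ _ [P [q [i sV sE]]] ->]]]].
by exists P, q; split=> //; apply: delta_eq.
Qed.

Lemma empty_rule_sub_id : sub_id_rule empty_rule.
Proof.
split; first by have [f _] := giso_id emptyG; apply: (inhabits f).
exists emptyG, (Defs.rel empty_rule); split; first exact: rule_iso_refl.
  by apply/subsetP => -[[]].
by apply/subsetP => -[[]].
Qed.

Lemma D_gen_comm (K : fieldType) (x y : R_DPO K) :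
  D_gen x -> D_gen y -> rmul x y = rmul y x.
Proof.
move=> /D_gen_normal[P1 [q1 [s1V s1E ->]]] /D_gen_normal[P2 [q2 [s2V s2E ->]]].
have rev_id (P : graph) (q : pmorph P P) : relV q \subset idrel (vert P) ->
    relE q \subset idrel (edge P) -> rule_iso (Rule q) (rule_rev (Rule q)).
  move=> sV sE; rewrite rule_iso_sym; apply: sub_id_rev; exists P, q.
  by split=> //; apply: rule_iso_refl.
(* Reversing both factors of the right-hand product turns it into the sum of the reversed composites
   of the left-hand one. *)
rewrite !rmul_delta (comp_sum_iso K (rev_id _ q2 s2V s2E) (rev_id _ q1 s1V s1E)).
rewrite comp_sum_rev; apply: eq_bigr => m _.
case e: (composite m) => [C|//].
(* Each composite is again contained in an identity, so reversal fixes its class. *)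
have [_] := composite_sub_id s1V s1E s2V s2E e.
by case: C {e} => G H r /sub_id_rev i; apply/esym/delta_eq.
Qed.

Theorem proposition6p3 (K : fieldType) :
  subalgebra (lin_span (@O_gen K)) /\
  [/\ subalgebra (lin_span (@D_gen K)),
      forall x : R_DPO K, lin_span (@D_gen K) x -> lin_span (@O_gen K) x
    & forall x y : R_DPO K,
        lin_span (@D_gen K) x -> lin_span (@D_gen K) y -> rmul x y = rmul y x].
Proof.
split; last split.
- apply: (lin_span_subalgebra (Q := card_preserving)) => [|x /O_genP //|].
    by apply/O_genP; exists empty_rule.
  move=> R1 R2 m C Q1 Q2 e; apply/O_genP; exists C => //.
  exact: composite_card_preserving e.
(* The factors are taken as partial identities on a single graph. Their composite runs between two
   isomorphic gluings, hence is a generator without having this literal form. *)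
- apply: (lin_span_subalgebra (Q := fun R => exists (P : graph) (q : pmorph P P),
      [/\ R = Rule q, relV q \subset idrel _ & relE q \subset idrel _])).
  + exact: D_gen_rule empty_rule_sub_id.
  + move=> x /D_gen_normal[P [q [sV sE ->]]]; exists (Rule q) => //.
    by exists P, q.
  + move=> R1 R2 m C [P1 [q1 [e1 s1V s1E]]] [P2 [q2 [e2 s2V s2E]]] e; subst.
    by apply: D_gen_rule; apply: composite_sub_id e.
- apply: lin_span_sub => x [G [H [r [[hV hE] _ _ ->]]]].
  by exists G, H, r.
- exact: lin_span_comm (@D_gen_comm K).
Qed.
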